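(* Let $\varphi_1 : (\mathbb{R}^n,0)\to(\mathbb{R}^n,0)$ be (the germ of) an involution and let $F:(\mathbb{R}^n,0)\to(\mathbb{R}^n,0)$ be a $\varphi_1$-reversible germ of diffeomorphism such that $F^m\neq I_n$ for all integers $m\ge 1$. Then $F$ has an infinite group of symmetries $\Gamma_+$ and an infinite set of reversing symmetries $\Gamma_-$.
   Context: All maps are germs at $0\in\mathbb{R}^n$ of maps fixing $0$; two maps defined near $0$ define the same germ if they agree on a neighborhood of $0$. $I_n$ is the germ of the identity map. $\Omega$ denotes the group under composition of invertible map germs $(\mathbb{R}^n,0)\to(\mathbb{R}^n,0)$. An involution is a germ of a diffeomorphism $\varphi:(\mathbb{R}^n,0)\to(\mathbb{R}^n,0)$ with $\varphi\circ\varphi=I_n$. For $\varphi\in\Omega$, a germ of diffeomorphism $F$ is $\varphi$-equivariant (and $\varphi$ is a symmetry of $F$) if $F\circ\varphi=\varphi\circ F$; it is $\varphi$-reversible (and $\varphi$ is a reversing symmetry of $F$) if $F\circ\varphi=\varphi\circ F^{-1}$. The group of symmetries of $F$ is $\Gamma_+=\{\varphi\in\Omega: F\circ\varphi=\varphi\circ F\}$ and the set of reversing symmetries of $F$ is $\Gamma_-=\{\varphi\in\Omega: F\circ\varphi=\varphi\circ F^{-1}\}$. *)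

(* Defs.v *)
From HB Require Import structures.
From mathcomp Require Import all_boot all_order all_algebra.
From mathcomp Require Import all_classical all_reals all_analysis.

Set Implicit Arguments.
Unset Strict Implicit.
Unset Printing Implicit Defensive.

Import Order.TTheory GRing.Theory Num.Theory numFieldNormedType.Exports.

Local Open Scope classical_set_scope.
Local Open Scope ring_scope.

Section Smoothness.
Variable R : realType.

(* Meant for [U] open. In finite dimension, continuity of [x |-> 'D_v f x] for
   every [v] is continuity of the differential for the operator norm. *)
Fixpoint Ck (V W : normedModType R) (k : nat) (U : set V) (f : V -> W) : Prop :=
  match k with
  | 0%N => forall x, U x -> {for x, continuous f}
  | k'.+1 => (forall x, U x -> differentiable f x) /\
             (forall v : V, Ck k' U (fun x => 'D_v f x))
  end.

(* [Some k] stands for the class C^k and [None] for C^oo. *)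
Definition smoothness := option nat.

Definition Cr (V W : normedModType R) (r : smoothness) (U : set V)
    (f : V -> W) : Prop :=
  if r is Some k then Ck k U f else forall k, Ck k U f.

Definition Cr_at (V W : normedModType R) (r : smoothness) (f : V -> W) (x : V) :=
  exists2 U : set V, open_nbhs x U & Cr r U f.

Section Closure.
Variables V W : normedModType R.
Implicit Types (f g : V -> W) (U : set V).

Lemma Ck_continuous k U f :
  Ck k U f -> forall x, U x -> {for x, continuous f}.
Proof.
by case: k => [//|k] [df _] x Ux; apply: differentiable_continuous; exact: df.
Qed.

Lemma Ck_pred k U f : Ck k.+1 U f -> Ck k U f.
Proof.
elim: k f => [|k IH] f Hf; first exact: Ck_continuous Hf.
by case: Hf => df Df; split => // v; exact: IH.
Qed.

Lemma Ck_sub k U U' f : U' `<=` U -> Ck k U f -> Ck k U' f.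
Proof.
move=> sU; elim: k f => [|k IH] f /=; first by move=> Hf x /sU; exact: Hf.
by move=> [df Df]; split => [x /sU /df //|v]; exact: IH.
Qed.

Lemma near_eq_differentiable f g x :
  (\near x, f x = g x) -> differentiable f x -> differentiable g x.
Proof.
move=> fg df.
have fgx : f x = g x := nbhs_singleton fg.
apply/diff_locallyP.
have fg0 : \forall y \near (0 : V), f (y + x) = g (y + x).
  by rewrite (near_shift 0 x) in fg; apply: filterS fg => y /=; rewrite subr0.
have dE : 'd g x = 'd f x :> (V -> W).
  apply: diff_unique; first exact: diff_continuous.
  apply/eqaddoP => e e0; have /eqaddoP/(_ e e0) := diff_locally df.
  by apply: filterS2 fg0 => y /= fgy; rewrite !fctE /= fgy fgx.
split; first by rewrite dE; exact: diff_continuous.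
rewrite dE; apply/eqaddoP => e e0; have /eqaddoP/(_ e e0) := diff_locally df.
by apply: filterS2 fg0 => y /= fgy; rewrite !fctE /= fgy fgx.
Qed.

Lemma Ck_eq k U f g :
  open U -> (forall x, U x -> f x = g x) -> Ck k U f -> Ck k U g.
Proof.
move=> oU; elim: k f g => [|k IH] f g fg.
  move=> cf x Ux; rewrite /prop_for /continuous_at -fg//.
  apply: cvg_trans (cf x Ux); apply: near_eq_cvg.
  by apply: filterS (open_nbhs_nbhs (conj oU Ux)) => y /fg.
have nfg x : U x -> \near x, f x = g x.
  by move=> Ux; apply: filterS (open_nbhs_nbhs (conj oU Ux)) => y /fg.
move=> [df Df]; split=> [x Ux|v].
  by apply: near_eq_differentiable (df x Ux); exact: nfg.
by apply: IH (Df v) => x Ux; apply: near_eq_derive; exact: nfg.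
Qed.

Lemma Ck_cst k U (w : W) : Ck k U (fun=> w).
Proof.
elim: k w => [|k IH] w; first by move=> x _; exact: cst_continuous.
split=> [x _|v]; first exact: differentiable_cst.
have -> : (fun x : V => 'D_v (fun=> w) x) = fun=> 0 :> W.
  by apply/funext => x; exact: derive_cst.
exact: IH.
Qed.

Lemma CkD k U f g : open U -> Ck k U f -> Ck k U g -> Ck k U (f + g).
Proof.
move=> oU; elim: k f g => [|k IH] f g.
  by move=> cf cg x Ux; apply: continuousD; [exact: cf|exact: cg].
move=> [df Df] [dg Dg]; split=> [x Ux|v].
  by apply: differentiableD; [exact: df|exact: dg].
apply: Ck_eq (IH _ _ (Df v) (Dg v)) => // x Ux; rewrite deriveD//.
- exact/diff_derivable/df.
- exact/diff_derivable/dg.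
Qed.

Lemma Ck_sum k U (I : Type) (s : seq I) (h : I -> V -> W) :
  open U -> (forall i, Ck k U (h i)) -> Ck k U (\sum_(i <- s) h i).
Proof.
move=> oU hU; elim/big_ind: _ => //; first exact: Ck_cst.
by move=> f g; exact: CkD.
Qed.

End Closure.

Lemma scaler_is_bilinear (W : normedModType R) :
  bilinear_for
    (GRing.Scale.Law.clone _ _ *:%R _) (GRing.Scale.Law.clone _ _ *:%R _)
    (fun (a : R^o) (w : W) => a *: w).
Proof.
split=> [w|u] a x y /=; first by rewrite scalerDl scalerA.
by rewrite scalerDr !scalerA mulrC.
Qed.

Lemma is_diff_scale (V W : normedModType R) (c dc : V -> R^o) (f df : V -> W) x :
  is_diff x c dc -> is_diff x f df ->
  is_diff x (fun y => c y *: f y) (fun y => c x *: df y + dc y *: f x).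
Proof.
move=> dcx dfx.
pose bM := bilinear_isBilinear.Build R R^o W W _ _ _ (scaler_is_bilinear W).
pose b : {bilinear R^o -> W -> W} := HB.pack (fun (a : R^o) (w : W) => a *: w) bM.
have cb : continuous (fun p : R^o * W => b p.1 p.2) by exact: scale_continuous.
have db : is_diff (c x, f x) (fun p : R^o * W => b p.1 p.2)
    (fun q => b (c x) q.2 + b q.1 (f x)).
  by apply: DiffDef; [exact: differentiable_bilin|rewrite diff_bilin].
by have := is_diff_comp (is_diff_pair dcx dfx) db.
Qed.

Lemma CkZ (V W : normedModType R) k U (c : V -> R^o) (f : V -> W) :
  open U -> Ck k U c -> Ck k U f -> Ck k U (fun x => c x *: f x).
Proof.
move=> oU; elim: k c f => [|k IH] c f.
  by move=> cc cf x Ux; apply: continuousZ; [exact: cc|exact: cf].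
move=> Hc Hf; have [[dc Dc] [df Df]] := (Hc, Hf).
have dcf x : U x -> is_diff x (fun y => c y *: f y)
    (fun y => c x *: 'd f x y + 'd c x y *: f x).
  move=> Ux; apply: is_diff_scale; apply: differentiableP; [exact: dc|exact: df].
split=> [x Ux|v]; first by have [] := dcf x Ux.
apply: (@Ck_eq _ _ _ _
  ((fun x => c x *: 'D_v f x) + (fun x => 'D_v c x *: f x))) => //.
  move=> x Ux; have dx := dcf x Ux; rewrite (deriveE v (@ex_diff _ _ _ _ _ _ _ dx)).
  by rewrite (@diff_val _ _ _ _ _ _ _ dx) !fctE !deriveE//; [exact: dc|exact: df].
apply: CkD => //.
  by apply: (IH c (fun x => 'D_v f x)); [exact: Ck_pred Hc|exact: Df].
by apply: (IH (fun x => 'D_v c x) f); [exact: Dc|exact: Ck_pred Hf].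
Qed.

Lemma Ck_lin (V W X : normedModType R) k U (l : {linear W -> X}) (f : V -> W) :
  continuous l -> open U -> Ck k U f -> Ck k U (l \o f).
Proof.
move=> cl oU; elim: k f => [|k IH] f.
  by move=> cf x Ux; apply: continuous_comp; [exact: cf|exact: cl].
move=> [df Df]; split=> [x Ux|v].
  by apply: differentiable_comp; [exact: df|exact: linear_differentiable].
apply: Ck_eq (IH _ (Df v)) => // x Ux /=.
have dlx : differentiable l (f x) by exact: linear_differentiable.
have dfx := df x Ux.
rewrite !deriveE//; last exact: differentiable_comp.
by rewrite (diff_comp dfx dlx) /= (diff_lin (f x) cl).
Qed.

Lemma Ck_coord (V : normedModType R) n k U (f : V -> 'rV[R]_n) j :
  open U -> Ck k U f -> Ck k U (fun x => f x 0 j : R^o).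
Proof.
have lin : linear (fun N : 'rV[R]_n => N 0 j : R^o).
  by move=> a u v; rewrite !mxE.
pose lM := GRing.isLinear.Build _ _ _ _ _ lin.
pose l : {linear 'rV[R]_n -> R^o} := HB.pack (fun N : 'rV[R]_n => N 0 j : R^o) lM.
by move=> oU cf; apply: (Ck_lin (l := l)) => //; exact: coord_continuous.
Qed.

Lemma Ck_id (V : normedModType R) k (U : set V) : Ck k U id.
Proof.
case: k => [|k]; first by move=> x _; exact: cvg_id.
split=> [x _|v]; first exact: (@ex_diff _ _ _ _ _ _ _ (is_diff_id x)).
have -> : (fun x : V => 'D_v id x) = fun=> v; last exact: Ck_cst.
apply/funext => x; rewrite deriveE; first by rewrite diff_val.
exact: (@ex_diff _ _ _ _ _ _ _ (is_diff_id x)).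
Qed.

Lemma Ck_comp (V W : normedModType R) n k (A : set V) (B : set 'rV[R]_n)
    (g : V -> 'rV[R]_n) (f : 'rV[R]_n -> W) :
  open A -> open B -> (forall x, A x -> B (g x)) ->
  Ck k A g -> Ck k B f -> Ck k A (f \o g).
Proof.
move=> oA oB AB; elim: k f => [|k IH] f.
  move=> cg cf x Ax; apply: continuous_comp; first exact: cg.
  exact/cf/AB.
move=> Hg Hf; have [[dg Dg] [df Df]] := (Hg, Hf).
split=> [x Ax|v]; first by apply: differentiable_comp; [exact: dg|exact/df/AB].
apply: (@Ck_eq _ _ _ _ (\sum_(j < n)
   (fun x => ('D_v g x 0 j : R^o) *: ('D_(delta_mx 0 j) f \o g) x))) => //.
  move=> x Ax; have dgx := dg _ Ax; have dfx := df _ (AB _ Ax).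
  have -> : 'D_v (f \o g) x = 'd f (g x) ('D_v g x).
    by rewrite (deriveE v (differentiable_comp dgx dfx)) (diff_comp dgx dfx) deriveE.
  rewrite fct_sumE [in RHS](row_sum_delta ('D_v g x)) linear_sum.
  by apply: eq_bigr => j _; rewrite linearZ /= (deriveE _ dfx).
apply: Ck_sum => // j; apply: CkZ => //.
  by apply: (Ck_coord (f := fun x => 'D_v g x)) => //; exact: Dg.
by apply: (IH (fun y => 'D_(delta_mx 0 j) f y)); [exact: Ck_pred Hg|exact: Df].
Qed.

End Smoothness.

Section Germs.
Variables (R : realType) (n : nat) (r : smoothness).
Local Notation E := 'rV[R]_n.

(* A map defined near [0] is represented by an arbitrary total extension of it:
   only the values near [0] matter for the germ. *)
Record local_map := LocalMap {
  local_map_fun :> E -> E;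
  local_map0 : local_map_fun 0 = 0;
  local_map_Cr : Cr_at r local_map_fun 0
}.

HB.instance Definition _ := gen_eqMixin local_map.
HB.instance Definition _ := gen_choiceMixin local_map.

Definition germ_eq (f g : local_map) : bool :=
  `[< \forall x \near (0 : E), f x = g x >].

Lemma germ_eqP (f g : local_map) :
  reflect (\forall x \near (0 : E), f x = g x) (germ_eq f g).
Proof. exact: asboolP. Qed.

#[local] Instance nbhs0_filter : Filter (nbhs (0 : E)) := nbhs_filter (0 : E).

Lemma germ_eq_refl : reflexive germ_eq.
Proof. by move=> f; apply/germ_eqP; exact: filterE. Qed.

Lemma germ_eq_sym : symmetric germ_eq.
Proof. by move=> f g; apply/idP/idP => /germ_eqP fg; apply/germ_eqP; apply: filterS fg. Qed.

Lemma germ_eq_trans : transitive germ_eq.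
Proof.
move=> g f h /germ_eqP fg /germ_eqP gh; apply/germ_eqP.
by apply: filterS2 fg gh => x -> ->.
Qed.

Canonical germ_equiv :=
  EquivRel germ_eq germ_eq_refl germ_eq_sym germ_eq_trans.

Definition map_germ : Type := {eq_quot germ_eq}%qT.

HB.instance Definition _ := Choice.on map_germ.
HB.instance Definition _ := EqQuotient.on map_germ.

Lemma eq_germP (f g : local_map) :
  (\pi_map_germ f = \pi_map_germ g)%qT <-> \forall x \near (0 : E), f x = g x.
Proof. by split=> [/eqquotP/germ_eqP//|fg]; apply/eqquotP/germ_eqP. Qed.

Lemma local_map_continuous (f : local_map) : f x @[x --> (0 : E)] --> (0 : E).
Proof.
case: f => f f0 [U [oU U0]] /= Hf; rewrite -[X in _ --> X]f0.
by case: r Hf => [k|/(_ 0%N)] /Ck_continuous; apply.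
Qed.

Lemma local_id_Cr : Cr_at r (@id E) 0.
Proof.
exists setT; first by split => //; exact: openT.
by case: r => [k|k]; exact: Ck_id.
Qed.

Definition local_id := LocalMap (erefl (0 : E)) local_id_Cr.

Lemma local_comp0 (f g : local_map) : (f \o g) 0 = 0.
Proof. by rewrite /= !local_map0. Qed.

Lemma local_comp_Cr (f g : local_map) : Cr_at r (f \o g) 0.
Proof.
case: f => f f0 [B [oB B0] Hf]; case: g => g g0 [A [oA A0] Hg] /=.
have cg x : A x -> {for x, continuous g}.
  by case: r Hg => [k|/(_ 0%N)] /Ck_continuous; apply.
have oAB : open (A `&` g @^-1` B).
  rewrite openE => x [Ax Bgx]; apply: filterI.
    exact: open_nbhs_nbhs.
  by apply: (cg x Ax); exact: open_nbhs_nbhs.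
exists (A `&` g @^-1` B); first by split=> //; split => //=; rewrite g0.
have AB x : (A `&` g @^-1` B) x -> B (g x) by case.
have key k : Ck k A g -> Ck k B f -> Ck k (A `&` g @^-1` B) (f \o g).
  by move=> kg kf; apply: (Ck_comp oAB oB AB _ kf); apply: Ck_sub kg => x [].
by case: r Hf Hg => [k Hf Hg|Hf Hg k]; exact: key.
Qed.

Definition local_comp (f g : local_map) :=
  LocalMap (local_comp0 f g) (local_comp_Cr f g).

Definition germ_one : map_germ := (\pi_map_germ local_id)%qT.

Definition germ_comp (a b : map_germ) : map_germ :=
  (\pi_map_germ (local_comp (repr a) (repr b)))%qT.

Lemma germ_compE (f g : local_map) :
  germ_comp (\pi_map_germ f)%qT (\pi_map_germ g)%qT =
  (\pi_map_germ (local_comp f g))%qT.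
Proof.
have reprE h : \forall x \near (0 : E), (repr (\pi_map_germ h)%qT) x = h x.
  by apply/eq_germP; rewrite reprK.
apply/eq_germP => /=.
have fg : \forall x \near (0 : E), (repr (\pi_map_germ f)%qT) (g x) = f (g x).
  exact: (@local_map_continuous g _ (reprE f)).
by apply: filterS2 fg (reprE g) => x /= fgx ->.
Qed.

Lemma germ_compA : associative germ_comp.
Proof.
elim/quotW=> f; elim/quotW=> g; elim/quotW=> h.
rewrite (germ_compE g h) (germ_compE f (local_comp g h)).
rewrite (germ_compE f g) (germ_compE (local_comp f g) h).
by apply/eq_germP; exact: filterE.
Qed.

Lemma germ_comp1 : left_id germ_one germ_comp.
Proof.
by elim/quotW=> f; rewrite (germ_compE local_id f); apply/eq_germP; exact: filterE.
Qed.

Lemma germ_1comp : right_id germ_one germ_comp.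
Proof.
by elim/quotW=> f; rewrite (germ_compE f local_id); apply/eq_germP; exact: filterE.
Qed.

(* [(a * b)%g] is the composition "a after b". *)
HB.instance Definition _ :=
  isMonoid.Build map_germ germ_compA germ_comp1 germ_1comp.

(* The inverse germ is required to be of class C^r as well. Hence, for
   [r <> Some 0], these are exactly the germs of C^r diffeomorphisms. *)
Definition germ_invertible (a : map_germ) : bool :=
  `[< exists b : map_germ, (a * b = 1)%g /\ (b * a = 1)%g >].

Record Omega := InvGerm {
  Omega_germ :> map_germ;
  Omega_invertible : germ_invertible Omega_germ
}.

HB.instance Definition _ := [isSub for Omega_germ].
HB.instance Definition _ := [Choice of Omega by <:].

Lemma Omega_inv_ex (a : Omega) :
  exists b : Omega, (Omega_germ a * Omega_germ b = 1)%g /\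
    (Omega_germ b * Omega_germ a = 1)%g.
Proof.
have /asboolP[b [ab ba]] := Omega_invertible a.
have b_inv : germ_invertible b by apply/asboolP; exists a.
by exists (InvGerm b_inv).
Qed.

Definition Omega_inv (a : Omega) : Omega := sval (cid (Omega_inv_ex a)).

Lemma Omega_one_subproof : germ_invertible 1%g.
Proof. by apply/asboolP; exists 1%g; rewrite mulg1. Qed.

Definition Omega_one : Omega := InvGerm Omega_one_subproof.

Lemma Omega_mul_subproof (a b : Omega) : germ_invertible (Omega_germ a * Omega_germ b)%g.
Proof.
have /asboolP[a' [aa' a'a]] := Omega_invertible a.
have /asboolP[b' [bb' b'b]] := Omega_invertible b.
apply/asboolP; exists (b' * a')%g; split.
  by rewrite mulgA -(mulgA _ _ b') bb' mulg1.
by rewrite mulgA -(mulgA _ a') a'a mulg1.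
Qed.

Definition Omega_mul (a b : Omega) : Omega := InvGerm (Omega_mul_subproof a b).

Lemma Omega_mulA : associative Omega_mul.
Proof. by move=> a b c; apply/val_inj; exact: mulgA. Qed.

Lemma Omega_mul1 : left_id Omega_one Omega_mul.
Proof. by move=> a; apply/val_inj; exact: mul1g. Qed.

Lemma Omega_1mul : right_id Omega_one Omega_mul.
Proof. by move=> a; apply/val_inj; exact: mulg1. Qed.

Lemma Omega_mulV : left_inverse Omega_one Omega_inv Omega_mul.
Proof. by move=> a; apply/val_inj; rewrite /Omega_inv; case: cid => b []. Qed.

Lemma Omega_Vmul : right_inverse Omega_one Omega_inv Omega_mul.
Proof. by move=> a; apply/val_inj; rewrite /Omega_inv; case: cid => b []. Qed.

HB.instance Definition _ := isGroup.Build Omega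
  Omega_mulA Omega_mul1 Omega_1mul Omega_mulV Omega_Vmul.

Definition involution (phi : Omega) : Prop := (phi * phi = 1)%g.

Definition equivariant (phi F : Omega) : Prop := (F * phi = phi * F)%g.

Definition reversible (phi F : Omega) : Prop := (F * phi = phi * F^-1)%g.

Definition Gamma_plus (F : Omega) : set Omega := [set phi | equivariant phi F].

Definition Gamma_minus (F : Omega) : set Omega := [set phi | reversible phi F].

End Germs.

(* Main.v *)
Require Import Defs.
From mathcomp Require Import all_boot all_order all_algebra.
From mathcomp Require Import all_classical all_reals all_analysis.

(** Everything takes place in the group of invertible germs: the hypothesis on
    [F] says that it has infinite order there, so its powers are pairwise
    distinct. All of them commute with [F], which makes the centralizer
    [Gamma_plus F] infinite. Composing a reversing symmetry with a symmetry
    gives a reversing symmetry, so the germs [F ^+ k * phi1] all reverse [F];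
    they are pairwise distinct because right translation by [phi1] is
    injective. *)

Lemma infinite_order_expg_inj (G : groupType) (x : G) :
  (forall m : nat, (1 <= m)%N -> (x ^+ m)%g <> 1%g) ->
  injective (fun k : nat => (x ^+ k)%g).
Proof.
move=> x_inf i j /=; wlog ltij : i j / (i < j)%N.
  move=> W xij; have [ij|ji|//] := ltngtP i j; first exact: W.
  by apply/esym/W.
move=> xij; case: (x_inf (j - i)%N); first by rewrite subn_gt0.
by rewrite expgnFr ?xij ?mulgV// ltnW.
Qed.

Lemma injective_seq_infinite {T : Type} (A : set T) (u : nat -> T) :
  injective u -> (forall k, A (u k)) -> infinite_set A.
Proof.
move=> u_inj uA; apply: (@sub_infinite_set _ (range u)).
  by move=> _ [k _ <-]; exact: uA.
by apply/infiniteP; rewrite (card_le_eqr (inj_card_eq (in2W u_inj))).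
Qed.

Lemma Gamma_plus_group_closed (R : realType) (n : nat) (r : smoothness)
  (F : Omega R n r) : group_closed (mem (Gamma_plus F)).
Proof.
split=> [|a b]; rewrite !inE; first exact: commute1.
by move=> Fa Fb; apply: commuteM => //; exact: commuteV.
Qed.

(** Moving [F] past [a] leaves it unchanged and moving it past [phi] inverts it,
    so moving it past the product inverts it once. *)
Lemma reversible_mul_equivariant (R : realType) (n : nat) (r : smoothness)
  (a phi F : Omega R n r) :
  equivariant a F -> reversible phi F -> reversible (a * phi)%g F.
Proof. by move=> Fa Fphi; rewrite /reversible mulgA Fa -!mulgA Fphi. Qed.

Theorem proposition2p3 (R : realType) (n : nat) (r : smoothness)
  (r_neq0 : r <> Some 0%N) (phi1 F : Omega R n r)
  (phi1_inv : involution phi1) (F_rev : reversible phi1 F)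
  (F_inf : forall m : nat, (1 <= m)%N -> (F ^+ m)%g <> 1%g) :
  [/\ group_closed (mem (Gamma_plus F)),
      infinite_set (Gamma_plus F) &
      infinite_set (Gamma_minus F)].
Proof.
have F_inj := infinite_order_expg_inj _ _ F_inf.
have FX k : Gamma_plus F (F ^+ k)%g by exact: commuteX.
split; first exact: Gamma_plus_group_closed.
  exact: injective_seq_infinite F_inj FX.
apply: (injective_seq_infinite _ (fun k => F ^+ k * phi1)%g) => [i j|k].
  by move/mulIg/F_inj.
exact: reversible_mul_equivariant (FX k) F_rev.
Qed.
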